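(* Let $(G,\cdot)$ and $(N,\star)$ be finite groups. The following are equivalent: (1) there exists a transitive action $\odot$ of $G$ on $N$ such that $(G,\cdot,N,\star,\odot)$ is a skew bracoid; (2) there exists a transitive subgroup $A$ of $\mathrm{Hol}(N)$ that is isomorphic to a quotient of $G$; (3) there exist a homomorphism $\gamma:G\to\mathrm{Aut}(N)$ and a surjective $1$-cocycle $\pi:G\to N$ (with respect to the action of $G$ on $N$ by automorphisms via $\gamma$).
   Context: All groups are finite. A (left) skew bracoid is a $5$-tuple $(G,\cdot,N,\star,\odot)$ such that $(G,\cdot)$ and $(N,\star)$ are groups and $\odot$ is a transitive action of $(G,\cdot)$ on the set $N$ such that $g\odot(\eta\star\mu)=(g\odot\eta)\star(g\odot e_N)^{-1}\star(g\odot\mu)$ for all $g\in G$ and $\eta,\mu\in N$, where $e_N$ is the identity of $N$ and inverses of elements of $N$ are taken in $(N,\star)$. $\mathrm{Perm}(N)$ is the group of permutations of the set $N$. The holomorph $\mathrm{Hol}(N)$ is the normalizer in $\mathrm{Perm}(N)$ of the image $\lambda_\star(N)$ of the left regular representation of $(N,\star)$; it equals the semidirect product $\lambda_\star(N)\,\mathrm{Aut}(N)$. A subgroup of $\mathrm{Perm}(N)$ is transitive if it acts transitively on $N$. Given a homomorphism $\gamma:G\to\mathrm{Aut}(N)$, a $1$-cocycle is a map $\pi:G\to N$ with $\pi(gh)=\pi(g)\star{}^{\gamma(g)}\pi(h)$ for all $g,h\in G$. *)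

(* Defs.v *)
From mathcomp Require Import all_boot all_fingroup.

Set Implicit Arguments.
Unset Strict Implicit.
Unset Printing Implicit Defensive.

Local Open Scope group_scope.

(* Actions in MathComp are right actions and the product of {perm T} is      *)
(* (s * t) x = t (s x).  Everything below is stated for LEFT actions, with    *)
(* homomorphisms into permutation groups taken with respect to the usual      *)
(* composition of functions; this is spelled out pointwise.                   *)

Definition left_action (G : finGroupType) (T : Type) (act : G -> T -> T) : Prop :=
  (forall x, act 1 x = x) /\ (forall g h x, act (g * h) x = act g (act h x)).

Definition transitive_act (G : finGroupType) (T : Type) (act : G -> T -> T) : Prop :=
  forall x y, exists g, act g x = y.

Record skew_bracoid (G N : finGroupType) (act : G -> N -> N) : Prop := SkewBracoid {
  skew_bracoid_action : left_action act;
  skew_bracoid_transitive : transitive_act act;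
  skew_bracoid_compat : forall g eta mu,
    act g (eta * mu) = act g eta * (act g 1)^-1 * act g mu
}.

Definition left_reg (N : finGroupType) (eta : N) : {perm N} := perm (mulgI eta).

Definition left_reg_image (N : finGroupType) : {set {perm N}} :=
  [set left_reg eta | eta in [set: N]].

(* The underlying set of the normaliser, and the isomorphism type of its      *)
(* subgroups, do not depend on the order in which permutations are composed.  *)
Definition Hol (N : finGroupType) : {group {perm N}} := 'N(left_reg_image N)%G.

(* gamma (g * h) is the composite of gamma g and gamma h, gamma h first: as   *)
(* an identity in {perm N} this reads gamma (g * h) = gamma h * gamma g.      *)
Definition hom_to_Aut (G N : finGroupType) (gamma : G -> {perm N}) : Prop :=
  (forall g, gamma g \in Aut [set: N]) /\
  (forall g h x, gamma (g * h) x = gamma g (gamma h x)).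

Definition cocycle (G N : finGroupType) (gamma : G -> {perm N}) (pi : G -> N) : Prop :=
  forall g h, pi (g * h) = pi g * gamma g (pi h).

(* Main.v *)
(* The three data determine each other: a skew bracoid action is recovered   *)
(* from a cocycle as g (.) x = pi g * gamma g x, with pi g = g (.) 1, and     *)
(* the compatibility axiom says that g (.) (eta * _) is a left translate of   *)
(* g (.) _, i.e. that g acts through the normaliser of the left translations. *)
Require Import Defs.
From mathcomp Require Import all_boot all_fingroup.

Local Open Scope group_scope.

(** An action of $G$ on $N$ is a homomorphism into $\mathrm{Perm}(N)$, and by [HolP] the bracoid
    axiom says exactly that it lands in the holomorph. Its image is then a quotient of $G$;
    conversely, $G \to G/K \cong A$ gives back an action, transitive because $A$ is. Splitting each
    $g\odot{}$ as an automorphism followed by left translation by $g\odot 1$ gives $\gamma$ and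
    $\pi$; since $\pi(G)$ is the orbit of $1$, transitivity becomes surjectivity of $\pi$. *)

Section LeftAction.

Variables (G : finGroupType) (T : finType) (act : G -> T -> T).
Hypothesis actP : left_action act.

Lemma left_actionK g : cancel (act g) (act g^-1).
Proof. by move=> x; case: actP => act1 actM; rewrite -actM mulVg act1. Qed.

(* The inverse turns the left action into a morphism for the product of      *)
(* {perm T}, which applies its left factor first.                            *)
Definition left_action_perm g : {perm T} := perm (can_inj (left_actionK g^-1)).

Lemma left_action_permM :
  {in [set: G] &, {morph left_action_perm : g h / g * h}}.
Proof.
move=> g h _ _; apply/permP=> x; rewrite permM !permE invMg.
by case: actP => _ ->.
Qed.

Canonical left_action_morphism := Morphism left_action_permM.

End LeftAction.

Lemma left_regE (N : finGroupType) (eta x : N) : left_reg eta x = eta * x.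
Proof. exact: permE. Qed.

(** Conjugating translation by [eta] with [s] sends [s mu] to [s (eta * mu)]. If this is again a
    translation, its value at [s 1] forces it to be the one by [s eta * (s 1)^-1]. *)
Lemma HolP (N : finGroupType) (s : {perm N}) :
  reflect (forall eta mu, s (eta * mu) = s eta * (s 1)^-1 * s mu)
          (s \in Hol N).
Proof.
apply: (iffP idP) => [sHol eta mu | sM].
  have: left_reg eta ^ s \in left_reg_image N.
    by rewrite memJ_norm // imset_f ?inE.
  case/imsetP=> nu _ lam_nu.
  have s_left x : s (eta * x) = nu * s x.
    by rewrite -left_regE -permJ lam_nu left_regE.
  by rewrite -{2}[eta]mulg1 !s_left mulgK.
rewrite inE; apply/subsetP=> _ /imsetP[_ /imsetP[eta _ ->] ->].
apply/imsetP; exists (s eta * (s 1)^-1); first by rewrite inE.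
apply/permP=> x; rewrite -[x](permKV s) permJ !left_regE.
exact: sM.
Qed.

Lemma skew_bracoid_Hol (G N : finGroupType) (act : G -> N -> N) :
  skew_bracoid act ->
  exists A : {group {perm N}},
    [/\ A \subset Hol N, [transitive A, on [set: N] | 'P]
      & exists2 K : {group G}, K <| [set: G] & A \isog [set: G] / K].
Proof.
case=> actP act_trans act_compat.
pose rho := left_action_morphism G N act actP.
exists (rho @* [set: G])%G; split.
- apply/subsetP=> _ /morphimP[g _ _ ->]; apply/HolP=> eta mu.
  by rewrite !permE.
- apply/imsetP; exists 1; rewrite ?inE //; apply/setP=> x; rewrite inE.
  have [g <-] := act_trans 1 x; apply/esym/orbitP.
  (* [rho] acts through inverses, so [rho g^-1] is [act g]. *)
  exists (rho g^-1); first by rewrite mem_morphim ?inE.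
  by rewrite /= apermE permE invgK.
- exists ('ker rho)%G; first exact: ker_normal.
  by rewrite isog_sym; apply: first_isog.
Qed.

Lemma Hol_skew_bracoid (G N : finGroupType) (A : {group {perm N}})
    (K : {group G}) :
    A \subset Hol N -> [transitive A, on [set: N] | 'P] ->
    K <| [set: G] -> A \isog [set: G] / K ->
  exists act : G -> N -> N, skew_bracoid act.
Proof.
move=> /subsetP sAH trA nKG; rewrite isog_sym => /isogP[f _ imf].
have nK g : g \in 'N(K) by apply: (subsetP (normal_norm nKG)); rewrite inE.
have Gq g : coset K g \in [set: G] / K by rewrite mem_quotient ?inE.
pose rho g := f (coset K g).
have rhoM g h : rho (g * h) = rho g * rho h.
  by rewrite /rho (morphM (coset_morphism K)) // (morphM f) ?Gq.
have rhoA g : rho g \in A by rewrite -imf mem_morphim.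
(* The inverse turns the right action [rho] into a left one. *)
exists (fun g x => rho g^-1 x); split.
- split=> [x | g h x]; first by rewrite invg1 /rho !morph1 perm1.
  by rewrite invMg rhoM permM.
- move=> x y.
  have [s sA ->] := atransP2 trA (in_setT x) (in_setT y).
  move: sA; rewrite -imf => /morphimP[_ _ /morphimP[g _ _ ->] ->].
  by exists g^-1; rewrite invgK.
- by move=> g; apply/HolP/sAH.
Qed.

Lemma skew_bracoid_cocycle (G N : finGroupType) (act : G -> N -> N) :
  skew_bracoid act ->
  exists (gamma : G -> {perm N}) (pi : G -> N),
    [/\ hom_to_Aut gamma, cocycle gamma pi
      & forall eta : N, exists g : G, pi g = eta].
Proof.
case=> actP act_trans act_compat; have [_ actM] := actP.
pose pi g := act g 1.
have gamma_inj g : injective (fun x => (pi g)^-1 * act g x).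
  by move=> x y /mulgI /(can_inj (left_actionK _ _ _ actP g)).
pose gamma g := perm (gamma_inj g).
have gammaE g x : gamma g x = (pi g)^-1 * act g x by rewrite permE.
have actE g x : act g x = pi g * gamma g x by rewrite gammaE mulKVg.
have gammaM g x y : gamma g (x * y) = gamma g x * gamma g y.
  by rewrite !gammaE act_compat !mulgA.
(* The cocycle law is [act (g * h) 1 = act g (act h 1)]. *)
have piM : cocycle gamma pi by move=> g h; rewrite -actE -actM.
exists gamma, pi; split=> //; last by move=> eta; apply: act_trans.
split=> [g | g h x].
  rewrite inE; apply/andP; split; first by apply/subsetP=> x; rewrite inE.
  by apply/morphicP=> x y _ _; apply: gammaM.
(* Expand [act (g * h) x] in two ways and cancel [pi (g * h)]. *)
by apply: (mulgI (pi (g * h))); rewrite -actE actM !actE gammaM piM mulgA.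
Qed.

Lemma cocycle_skew_bracoid (G N : finGroupType) (gamma : G -> {perm N})
    (pi : G -> N) :
    hom_to_Aut gamma -> cocycle gamma pi ->
    (forall eta : N, exists g : G, pi g = eta) ->
  exists act : G -> N -> N, skew_bracoid act.
Proof.
move=> [gammaA gammaM] piM pi_surj.
have gammaD g x y : gamma g (x * y) = gamma g x * gamma g y.
  have /morphicP := Aut_morphic (gammaA g).
  by apply; rewrite inE.
have gamma_id1 g : gamma g 1 = 1.
  by apply: (mulgI (gamma g 1)); rewrite -gammaD !mulg1.
have gamma1 x : gamma 1 x = x.
  by apply: (@perm_inj _ (gamma 1)); rewrite -gammaM mulg1.
have pi1 : pi 1 = 1.
  by apply: (mulgI (pi 1)); rewrite -{2}[pi 1]gamma1 -piM !mulg1.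
pose act g x := pi g * gamma g x.
have act1 x : act 1 x = x by rewrite /act pi1 gamma1 mul1g.
have actM g h x : act (g * h) x = act g (act h x).
  by rewrite /act piM gammaM gammaD mulgA.
have act_id1 g : act g 1 = pi g by rewrite /act gamma_id1 mulg1.
exists act; split=> // [x y | g eta mu].
  (* Every point is [act g 1] for some [g], so one can move from [x] to [y] through [1]. *)
  have [g <-] := pi_surj x; have [h <-] := pi_surj y.
  by exists (h * g^-1); rewrite -!act_id1 -actM mulgKV.
by rewrite act_id1 /act gammaD !mulgA mulgKV.
Qed.

Theorem theorem2p8 (G N : finGroupType) :
  ((exists act : G -> N -> N, skew_bracoid act) <->
   (exists A : {group {perm N}},
      [/\ A \subset Hol N, [transitive A, on [set: N] | 'P]
        & exists2 K : {group G}, K <| [set: G] & A \isog [set: G] / K]))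
  /\
  ((exists A : {group {perm N}},
      [/\ A \subset Hol N, [transitive A, on [set: N] | 'P]
        & exists2 K : {group G}, K <| [set: G] & A \isog [set: G] / K]) <->
   (exists (gamma : G -> {perm N}) (pi : G -> N),
      [/\ hom_to_Aut gamma, cocycle gamma pi
        & forall eta : N, exists g : G, pi g = eta])).
Proof.
have H12 act := skew_bracoid_Hol G N act.
have H13 act := skew_bracoid_cocycle G N act.
split; split.
- by case=> act /H12.
- by case=> A [sAH trA [K nKG isoAK]]; apply: (Hol_skew_bracoid G N A K).
- case=> A [sAH trA [K nKG isoAK]].
  by have [act /H13] := Hol_skew_bracoid G N A K sAH trA nKG isoAK.
- case=> gamma [pi [gammaP piP pi_surj]].
  by have [act /H12] := cocycle_skew_bracoid G N gamma pi gammaP piP pi_surj.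
Qed.
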